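(* Let $\boldsymbol{\mu}^*\in(0,\infty)^J$ be an optimal solution (global minimizer) of the dual problem $\min_{\boldsymbol{\mu}} g(\boldsymbol{\mu})$, where $$g(\boldsymbol{\mu})=\sum_{j\in\mathcal{J}}\mu_j+\sum_{i\in\mathcal{I}}\max_{j\in\mathcal{J}}\frac{\alpha_i}{1-\alpha_i}\,\widehat{\gamma}_{ij}\,\mu_j^{\frac{\alpha_i-1}{\alpha_i}} .$$ Let $T\ge 1$ be the number of iterations, let $\boldsymbol{\mu}^{(1)}\in(0,\infty)^J$ be an initial price vector, and let $(\boldsymbol{\mu}^{(t)})_{t\ge 1}$ be generated with constant step size $\eta$ by $$\mu_j^{(t+1)}=\max\bigl(0,\ \mu_j^{(t)}-\eta\,[\mathbf{g}_t]_j\bigr),\qquad [\mathbf{g}_t]_j=1-\sum_{i\in\mathcal{I}_j^{(t)}}\widehat{\gamma}_{ij}\,\bigl(\mu_j^{(t)}\bigr)^{-\frac{1}{\alpha_i}},\qquad j\in\mathcal{J},$$ where $\mathcal{I}_j^{(t)}=\{i\in\mathcal{I}: j_i^{(t)}=j\}$ and, for every $i\in\mathcal{I}$, $j_i^{(t)}$ is a chosen element of $\operatorname{argmax}_{k\in\mathcal{J}}\gamma_{ik}/\mu_k^{(t)}$. Assume that all iterates lie in $(0,\infty)^J$ (so that the vectors $\mathbf{g}_t$ are well defined) and that there is a constant $G>0$ with $\Vert\mathbf{g}_t\Vert\le G$ for all $t\in\mathbb{N}$, $t\ge 1$. If $$\eta=\frac{\Vert\boldsymbol{\mu}^{(1)}-\boldsymbol{\mu}^*\Vert}{G\sqrt{T}},$$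 then $$\min_{1\le t\le T} g(\boldsymbol{\mu}^{(t)})-g(\boldsymbol{\mu}^* )\ \le\ \frac{G\,\Vert\boldsymbol{\mu}^{(1)}-\boldsymbol{\mu}^*\Vert}{\sqrt{T}} .$$
   Context: $\mathcal{I}=\{1,\dots,I\}$ (users) and $\mathcal{J}=\{1,\dots,J\}$ (base stations) are finite nonempty index sets. For $i\in\mathcal{I}$, $j\in\mathcal{J}$, $\gamma_{ij}>0$ is a given real number (spectral efficiency), and each user $i$ has a parameter $\alpha_i\in(0,1)\cup(1,\infty)$. Put $\widehat{\gamma}_{ij}=\gamma_{ij}^{\frac{1}{\alpha_i}-1}$. The function $g$ is regarded as a real-valued function on $(0,\infty)^J$. $\Vert\cdot\Vert$ is the Euclidean norm on $\mathbb{R}^J$. *)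

(* Defs.v *)
From HB Require Import structures.
From mathcomp Require Import all_boot all_order all_algebra.
From mathcomp Require Import reals exp.

Set Implicit Arguments.
Unset Strict Implicit.
Unset Printing Implicit Defensive.

Import Order.TTheory GRing.Theory Num.Theory.

Local Open Scope ring_scope.

(* The nonempty index sets {1..I} and {1..J} are
   'I_m.+1 and 'I_n.+1, and R^J is 'rV[R]_n.+1. *)

(* The norm that MathComp-Analysis puts on matrices is the sup norm, so the
   Euclidean norm is defined here. *)
Definition norm2 (R : realType) (n : nat) (x : 'rV[R]_n) : R :=
  Num.sqrt (\sum_(j < n) x ord0 j ^+ 2).

Definition posv (R : realType) (n : nat) (x : 'rV[R]_n) : Prop :=
  forall j, 0 < x ord0 j.

Definition is_argmax (R : realType) (T : Type) (f : T -> R) (j : T) : Prop :=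
  forall k, f k <= f j.

Section NetworkUtility.
Variables (R : realType) (m n : nat).
Variables (gamma : 'I_m.+1 -> 'I_n.+1 -> R) (alpha : 'I_m.+1 -> R).

Definition gammahat (i : 'I_m.+1) (j : 'I_n.+1) : R :=
  gamma i j `^ ((alpha i)^-1 - 1).

Definition dual_term (mu : 'rV[R]_n.+1) (i : 'I_m.+1) (j : 'I_n.+1) : R :=
  alpha i / (1 - alpha i) * gammahat i j
    * mu ord0 j `^ ((alpha i - 1) / alpha i).

(* The terms may be negative (alpha i > 1), so the seed of the iterated maximum
   is one of the terms rather than 0. *)
Definition dual_obj (mu : 'rV[R]_n.+1) : R :=
  \sum_(j < n.+1) mu ord0 j
  + \sum_(i < m.+1) \big[Num.max/dual_term mu i ord0]_(j < n.+1) dual_term mu i j.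

Definition dual_minimizer (mu : 'rV[R]_n.+1) : Prop :=
  posv mu /\ forall nu, posv nu -> dual_obj mu <= dual_obj nu.

(* s i is the base station chosen by user i at the prices mu. *)
Definition dual_subgrad (mu : 'rV[R]_n.+1) (s : 'I_m.+1 -> 'I_n.+1) :
    'rV[R]_n.+1 :=
  \row_j (1 - \sum_(i < m.+1 | s i == j)
                gammahat i j * mu ord0 j `^ (- (alpha i)^-1)).

End NetworkUtility.

(* Main.v *)
(* The dual term of user i at station j is a nondecreasing function of
   gamma_ij / mu_j, so the station chosen by user i also attains the maximum in
   the dual objective.  Each term is convex in mu_j, so the tangent of the active
   term minorizes the maximum, which makes g_t a subgradient at mu^(t).
   Projection onto the orthant does not increase the distance to mustar, so
   |mu^(t+1) - mustar|^2 <=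
     |mu^(t) - mustar|^2 - 2 eta (g(mu^(t)) - g(mustar)) + eta^2 G^2;
   telescoping over T steps gives the bound. *)

Require Import Defs.
From HB Require Import structures.
From mathcomp Require Import all_boot all_order all_algebra.
From mathcomp Require Import ring lra.
From mathcomp Require Import reals sequences exp.

Set Implicit Arguments.
Unset Strict Implicit.
Unset Printing Implicit Defensive.

Import Order.TTheory GRing.Theory Num.Theory.

Local Open Scope ring_scope.

(** * Tangent bounds and monotonicity for [z ^ p / p] with [p <= 1] nonzero *)

Section PowerFunction.
Variable R : realType.
Implicit Types p u x y z : R.

Lemma expRM_le_tangent p u : 0 <= p <= 1 -> expR (p * u) <= 1 + p * (expR u - 1).
Proof.
move=> /andP[p_ge0 p_le1].
(* Convex combination of the tangent bounds of expR at [p * u], taken at the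
   points [u] and [0]. *)
have tangent w : expR (p * u) * (1 + (w - p * u)) <= expR w.
  rewrite -[w in leRHS](subrKC (p * u)) expRD ler_pM2l ?expR_gt0 //.
  exact: expR_ge1Dx.
have := tangent u; have := tangent 0; rewrite expR0.
move: (expR (p * u)) (expR u) => a b h0 hu.
have h1 : p * (a * (1 + (u - p * u))) <= p * b by rewrite ler_wpM2l.
have h2 : (1 - p) * (a * (1 + (0 - p * u))) <= (1 - p) * 1.
  by rewrite ler_wpM2l // subr_ge0.
lra.
Qed.

(** Chains [1 + p * u <= expR (p * u)] with [u <= expR u - 1], which the factor [p <= 0]
    reverses. *)
Lemma expRM_ge_tangent p u : p <= 0 -> 1 + p * (expR u - 1) <= expR (p * u).
Proof.
move=> p_le0; apply: le_trans (expR_ge1Dx (p * u)).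
rewrite lerD2l ler_wnM2l // lerBrDl; exact: expR_ge1Dx.
Qed.

(** Bernoulli's inequality, through [u = ln z]. Its direction depends on the sign of [p]; dividing
    by [p] absorbs this, so both ranges of [alpha] are covered by one concavity statement. *)
Lemma powR_div_le_tangent p z : p != 0 -> p <= 1 -> 0 < z ->
  z `^ p / p <= p^-1 + (z - 1).
Proof.
move=> p_neq0 p_le1 z_gt0.
have -> : p^-1 + (z - 1) = (1 + p * (z - 1)) / p by field.
have zE : z = expR (ln z) by rewrite lnK.
have zpE : z `^ p = expR (p * ln z) by rewrite /powR gt_eqF.
case: (ltrgtP p 0) p_neq0 => // p0 _.
- rewrite ler_ndivrMr // divfK ?lt_eqF // zpE {1}zE.
  exact: expRM_ge_tangent (ltW p0).
- rewrite ler_pdivrMr // divfK ?gt_eqF // zpE {2}zE.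
  by apply: expRM_le_tangent; rewrite (ltW p0).
Qed.

(** The tangent bound at 1, applied to [z = x / y] and rescaled by [y ^ p]. *)
Lemma powR_div_le_tangent_at p x y : p != 0 -> p <= 1 -> 0 < x -> 0 < y ->
  x `^ p / p <= y `^ p / p + y `^ (p - 1) * (x - y).
Proof.
move=> p_neq0 p_le1 x_gt0 y_gt0.
have /(ler_wpM2l (powR_ge0 y p)) :=
  powR_div_le_tangent p_neq0 p_le1 (divr_gt0 x_gt0 y_gt0).
rewrite mulrA -powRM ?(ltW y_gt0) ?(ltW (divr_gt0 _ _)) //.
rewrite mulrCA divff ?gt_eqF // mulr1.
rewrite powRB ?powRr1 ?(ltW y_gt0) ?(gt_eqF y_gt0) ?implybT //.
move=> /le_trans; apply; rewrite le_eqVlt; apply/predU1P; left.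
by field; rewrite p_neq0 gt_eqF.
Qed.

Lemma powR_div_homo p x y : p != 0 -> 0 < x -> x <= y -> x `^ p / p <= y `^ p / p.
Proof.
move=> p_neq0 x_gt0 le_xy; have y_gt0 := lt_le_trans x_gt0 le_xy.
rewrite /powR !gt_eqF //.
case: (ltrgtP p 0) p_neq0 => // p0 _.
- by rewrite ler_nM2r ?invr_lt0 // ler_expR ler_nM2l // ler_ln.
- by rewrite ler_pM2r ?invr_gt0 // ler_expR ler_pM2l // ler_ln.
Qed.

End PowerFunction.

(** * The subgradient inequality for the dual objective *)

Section DualSubgradient.
Variables (R : realType) (m n : nat).
Variables (gamma : 'I_m.+1 -> 'I_n.+1 -> R) (alpha : 'I_m.+1 -> R).
Hypothesis gamma_gt0 : forall i j, 0 < gamma i j.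
Hypothesis alpha_dom : forall i, 0 < alpha i < 1 \/ 1 < alpha i.

Implicit Types (mu nu : 'rV[R]_n.+1) (i : 'I_m.+1) (j : 'I_n.+1).

(** Both the coefficient, [1 / q i], and the exponent, [- q i], of a dual term depend on [alpha i]
    only through this number, positive exactly when [alpha i < 1]. *)
Let q i := (alpha i)^-1 - 1.

Let alpha_gt0 i : 0 < alpha i.
Proof. by case: (alpha_dom i) => [/andP[]//|]; apply: lt_trans. Qed.

Let alpha_neq1 i : 1 - alpha i != 0.
Proof.
by rewrite subr_eq0 eq_sym; case: (alpha_dom i) => [/andP[_ /lt_eqF->]|/gt_eqF->].
Qed.

Let q_neq0 i : q i != 0.
Proof.
rewrite /q subr_eq0 invr_eq1 eq_sym -subr_eq0; exact: alpha_neq1.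
Qed.

Let coefE i : alpha i / (1 - alpha i) = (q i)^-1.
Proof.
by rewrite -invf_div mulrBl div1r divff ?gt_eqF.
Qed.

Let exponentE i : (alpha i - 1) / alpha i = - q i.
Proof. by rewrite /q; field; rewrite gt_eqF. Qed.

(** In this form the term is an increasing function of the ratio that user [i] maximizes, whatever
    the sign of [q i]. *)
Lemma dual_termE mu i j : posv mu ->
  dual_term gamma alpha mu i j = (gamma i j / mu ord0 j) `^ q i / q i.
Proof.
move=> mu_gt0; rewrite /dual_term /gammahat coefE exponentE.
rewrite powRM ?invr_ge0 ?(ltW (gamma_gt0 i j)) ?(ltW (mu_gt0 j)) // -mulrA mulrC; congr (_ * _ / _).
by rewrite -(powR_inv1 (ltW (mu_gt0 j))) -powRrM mulN1r.
Qed.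

Lemma dual_term_argmax mu i j k : posv mu ->
  is_argmax (fun l => gamma i l / mu ord0 l) j ->
  dual_term gamma alpha mu i k <= dual_term gamma alpha mu i j.
Proof.
move=> mu_gt0 jmax; rewrite !dual_termE //.
by apply: powR_div_homo => //; apply: divr_gt0.
Qed.

(** With [p = - q i], the term is the nonnegative factor [gammahat] times the convex function
    [- y ^ p / p], whose slope is [- y ^ (p - 1)], and [p - 1 = - 1 / alpha i]. *)
Lemma dual_term_tangent mu nu i j : posv mu -> posv nu ->
  dual_term gamma alpha mu i j
    - gammahat gamma alpha i j * mu ord0 j `^ (- (alpha i)^-1)
        * (nu ord0 j - mu ord0 j)
  <= dual_term gamma alpha nu i j.
Proof.
move=> mu_gt0 nu_gt0; rewrite /dual_term coefE exponentE.
have p_le1 : - q i <= 1 by rewrite /q opprB gerBl invr_ge0 ltW.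
have p_neq0 : - q i != 0 by rewrite oppr_eq0.
have := powR_div_le_tangent_at p_neq0 p_le1 (nu_gt0 j) (mu_gt0 j).
have -> : - q i - 1 = - (alpha i)^-1 by rewrite /q; ring.
move=> /(ler_wpM2l (powR_ge0 (gamma i j) (q i))).
rewrite -/(gammahat gamma alpha i j) invrN !mulrDr.
lra.
Qed.

Lemma dual_obj_subgrad mu nu (s : 'I_m.+1 -> 'I_n.+1) : posv mu -> posv nu ->
  (forall i, is_argmax (fun k => gamma i k / mu ord0 k) (s i)) ->
  dual_obj gamma alpha mu
    + \sum_j dual_subgrad gamma alpha mu s ord0 j * (nu ord0 j - mu ord0 j)
  <= dual_obj gamma alpha nu.
Proof.
move=> mu_gt0 nu_gt0 smax.
pose c i j := gammahat gamma alpha i j * mu ord0 j `^ (- (alpha i)^-1).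
have -> : \sum_j dual_subgrad gamma alpha mu s ord0 j * (nu ord0 j - mu ord0 j)
    = \sum_j nu ord0 j - \sum_j mu ord0 j
      - \sum_i c i (s i) * (nu ord0 (s i) - mu ord0 (s i)).
  rewrite -sumrB.
  (* Regroups the users by the station they choose. *)
  have -> : \sum_i c i (s i) * (nu ord0 (s i) - mu ord0 (s i)) =
      \sum_j \sum_(i | s i == j) c i j * (nu ord0 j - mu ord0 j).
    rewrite (exchange_big_dep predT) //=; apply: eq_bigr => i _.
    by rewrite (big_pred1 (s i)) // => j; rewrite eq_sym.
  rewrite -sumrB; apply: eq_bigr => j _.
  by rewrite mxE mulrBl mul1r mulr_suml.
rewrite /dual_obj; set A := \sum_j mu _ _; set B := \sum_j nu _ _.
rewrite [leLHS](_ : _ = B + (\sum_i \big[Num.max/dual_term gamma alpha mu i ord0]_j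
    dual_term gamma alpha mu i j
    - \sum_i c i (s i) * (nu ord0 (s i) - mu ord0 (s i)))); last by ring.
rewrite lerD2l -sumrB; apply: ler_sum => i _.
(* At [nu] the station [s i] need not be optimal, but its term bounds the maximum from below; at
   [mu] it attains the maximum. *)
apply: le_trans (le_bigmax _ _ (s i)).
apply: le_trans (dual_term_tangent i (s i) mu_gt0 nu_gt0).
rewrite lerD2r; apply/bigmax_leP; split=> [|k _]; exact: dual_term_argmax.
Qed.

End DualSubgradient.

(** * Euclidean norm, projected step and averaging *)

Lemma norm2_ge0 (R : realType) n (x : 'rV[R]_n) : 0 <= norm2 x.
Proof. exact: sqrtr_ge0. Qed.

Lemma norm2_sqr (R : realType) n (x : 'rV[R]_n) :
  norm2 x ^+ 2 = \sum_j x ord0 j ^+ 2.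
Proof. by rewrite sqr_sqrtr // sumr_ge0 // => j _; apply: sqr_ge0. Qed.

Lemma norm2_eq0 (R : realType) n (x : 'rV[R]_n) : norm2 x = 0 -> x = 0.
Proof.
move=> x0; have /esym/eqP := norm2_sqr x; rewrite x0 expr0n psumr_eq0 /=; last first.
  by move=> j _; apply: sqr_ge0.
move=> /allP xj0; apply/rowP => j; rewrite mxE; apply/eqP.
by rewrite -sqrf_eq0 xj0 ?mem_index_enum.
Qed.

Lemma projected_step_norm2 (R : realType) n (x x' g y : 'rV[R]_n) (eta : R) :
  posv y ->
  (forall j, x' ord0 j = Num.max 0 (x ord0 j - eta * g ord0 j)) ->
  norm2 (x' - y) ^+ 2 <= norm2 (x - y) ^+ 2
    + 2 * eta * (\sum_j g ord0 j * (y ord0 j - x ord0 j)) + eta ^+ 2 * norm2 g ^+ 2.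
Proof.
move=> y_gt0 x'E; rewrite !norm2_sqr !mulr_sumr -!big_split /=.
apply: ler_sum => j _; rewrite !mxE x'E.
have := y_gt0 j; move: (x ord0 j) (g ord0 j) (y ord0 j) => a b c c_gt0.
rewrite [leRHS](_ : _ = (a - eta * b - c) ^+ 2); last by ring.
(* If the coordinate is clipped, then [a - eta * b < 0 < c], so 0 is closer to [c]. *)
case: (leP 0 (a - eta * b)) => // h; nra.
Qed.

(** A minimum is at most the average; the seed [x0] is arbitrary because it can only lower the
    minimum. *)
Lemma bigmin_nat_sum_le (R : realType) (x0 : R) (f : nat -> R) (T : nat) :
  T%:R * \big[Num.min/x0]_(1 <= t < T.+1) f t <= \sum_(1 <= t < T.+1) f t.
Proof.
rewrite mulr_natl.
have -> : \big[Num.min/x0]_(1 <= t < T.+1) f t *+ T =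
    \sum_(1 <= k < T.+1) \big[Num.min/x0]_(1 <= t < T.+1) f t.
  by rewrite sumr_const_nat subn1.
rewrite big_nat_cond [leRHS]big_nat_cond; apply: ler_sum => t /andP[t_range _].
by apply: ge_bigmin_seq; rewrite ?mem_index_iota.
Qed.

Theorem theorem1 (R : realType) (m n : nat)
  (gamma : 'I_m.+1 -> 'I_n.+1 -> R) (alpha : 'I_m.+1 -> R)
  (gamma_gt0 : forall i j, 0 < gamma i j)
  (alpha_dom : forall i, 0 < alpha i < 1 \/ 1 < alpha i)
  (mustar : 'rV[R]_n.+1)
  (mustar_opt : dual_minimizer gamma alpha mustar)
  (T : nat) (T_ge1 : (1 <= T)%N)
  (eta G : R)
  (mu : nat -> 'rV[R]_n.+1) (s : nat -> 'I_m.+1 -> 'I_n.+1)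
  (mu_pos : forall t, (1 <= t)%N -> posv (mu t))
  (s_argmax : forall t i, (1 <= t)%N ->
     is_argmax (fun k => gamma i k / mu t ord0 k) (s t i))
  (mu_step : forall t j, (1 <= t)%N ->
     mu t.+1 ord0 j =
       Num.max 0 (mu t ord0 j
                  - eta * dual_subgrad gamma alpha (mu t) (s t) ord0 j))
  (G_gt0 : 0 < G)
  (subgrad_bound : forall t, (1 <= t)%N ->
     norm2 (dual_subgrad gamma alpha (mu t) (s t)) <= G)
  (eta_def : eta = norm2 (mu 1%N - mustar) / (G * Num.sqrt T%:R)) :
  \big[Num.min/dual_obj gamma alpha (mu 1%N)]_(1 <= t < T.+1)
      dual_obj gamma alpha (mu t)
    - dual_obj gamma alpha mustar
  <= G * norm2 (mu 1%N - mustar) / Num.sqrt T%:R.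
Proof.
set g := dual_obj gamma alpha; set D := norm2 (mu 1%N - mustar).
set M := \big[_/_]_(_ <= _ < _) _.
set r := Num.sqrt T%:R in eta_def *.
have [mustar_gt0 _] := mustar_opt.
have D_ge0 : 0 <= D := norm2_ge0 _.
have r_gt0 : 0 < r by rewrite sqrtr_gt0 ltr0n.
have r_sqr : r ^+ 2 = T%:R by rewrite sqr_sqrtr ?ler0n.
have T_gt0 : 0 < T%:R :> R by rewrite ltr0n.
(* If [D = 0] then [eta = 0] and the factor [2 * eta] cannot be cancelled, but the first iterate is
   already [mustar]. *)
have [D0|D_neq0] := eqVneq D 0.
  have /eqP := norm2_eq0 D0; rewrite subr_eq0 => /eqP mu1E.
  rewrite D0 mulr0 mul0r subr_le0 -mu1E.
  by apply: ge_bigmin_seq; rewrite ?mem_index_iota.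
have eta_gt0 : 0 < eta by rewrite eta_def divr_gt0 ?mulr_gt0 // lt_neqAle eq_sym D_neq0.
have step t : (1 <= t)%N -> 2 * eta * (g (mu t) - g mustar) <=
    norm2 (mu t - mustar) ^+ 2 - norm2 (mu t.+1 - mustar) ^+ 2 + eta ^+ 2 * G ^+ 2.
  move=> t_ge1.
  have := projected_step_norm2 mustar_gt0 (fun j => mu_step t j t_ge1).
  have := dual_obj_subgrad gamma_gt0 alpha_dom (mu_pos t t_ge1) mustar_gt0
            (fun i => s_argmax t i t_ge1).
  rewrite -/g; set S := \sum_j _ => sub.
  have : eta ^+ 2 * norm2 (dual_subgrad gamma alpha (mu t) (s t)) ^+ 2
      <= eta ^+ 2 * G ^+ 2.
    by rewrite ler_wpM2l ?sqr_ge0 // lerXn2r ?nnegrE ?norm2_ge0 ?subgrad_bound // ltW.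
  have : 2 * eta * (g (mu t) - g mustar) <= 2 * eta * - S.
    by rewrite ler_pM2l ?mulr_gt0 //; lra.
  lra.
have total : 2 * eta * (\sum_(1 <= t < T.+1) g (mu t) - T%:R * g mustar) <=
    D ^+ 2 + T%:R * (eta ^+ 2 * G ^+ 2).
  have constE c : T%:R * c = \sum_(1 <= t < T.+1) c :> R.
    by rewrite sumr_const_nat subn1 mulr_natl.
  rewrite !constE -sumrB mulr_sumr.
  have /le_trans-> // : \sum_(1 <= t < T.+1) 2 * eta * (g (mu t) - g mustar) <=
      \sum_(1 <= t < T.+1) (norm2 (mu t - mustar) ^+ 2
        - norm2 (mu t.+1 - mustar) ^+ 2 + eta ^+ 2 * G ^+ 2).
    rewrite big_nat_cond [leRHS]big_nat_cond; apply: ler_sum => t.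
    by move=> /andP[/andP[/step]].
  rewrite big_split lerD2r /=.
  (* The sum collapses to [D ^+ 2] minus the squared distance of iterate [T.+1] from [mustar], which
     is then dropped. *)
  rewrite (telescope_sumr_eq (fun t => - norm2 (mu t - mustar) ^+ 2)) //; last first.
    by move=> t _; rewrite opprK addrC.
  by rewrite opprK addrC gerBl sqr_ge0.
have etaE : eta * (G * r) = D by rewrite eta_def divfK ?gt_eqF ?mulr_gt0.
(* The choice of [eta] makes the accumulated step error equal to the initial squared distance, so
   the total is [2 * D ^+ 2]. *)
have etaG : T%:R * (eta ^+ 2 * G ^+ 2) = D ^+ 2 by rewrite -etaE -r_sqr; ring.
have M_le : T%:R * M <= \sum_(1 <= t < T.+1) g (mu t) := bigmin_nat_sum_le _ _ T.
have : 2 * eta * (T%:R * (M - g mustar)) <= 2 * D ^+ 2.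
  apply: (@le_trans _ _ (D ^+ 2 + T%:R * (eta ^+ 2 * G ^+ 2))).
    apply: le_trans total; rewrite mulrBr ler_pM2l ?mulr_gt0 //; lra.
  by rewrite etaG; lra.
(* One factor [D] is replaced by [eta * (G * r)], and [r = T / r], to expose the common positive
   factor [2 * eta * T]. *)
have -> : 2 * D ^+ 2 = 2 * eta * (T%:R * (G * D / r)).
  by rewrite expr2 -{1}etaE -r_sqr; field; rewrite gt_eqF.
by rewrite ler_pM2l ?mulr_gt0 // ler_pM2l.
Qed.
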